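(* Let $Q\subset\mathbb{R}^2$ be a rational polygon with vertex set $V$, and let $$B=\{q\in Q\setminus V:\ \text{there is no direction }\varphi\in\mathbf{S}^1\text{ for which }(q,\varphi)\text{ is a periodic point of the billiard flow}\}.$$ If $Q$ is convex, then $B$ is contained in a finite union of line segments. If $Q$ is a triangle, then $B$ is finite (possibly empty).
   Context: A polygon is rational if the angle between each pair of its sides is a rational multiple of $\pi$. The billiard flow: a point moves inside $Q$ with unit speed along straight lines and reflects at the boundary by the mirror law; trajectories hitting a vertex are continued by continuity from the left (with respect to a fixed orientation of $\partial Q$). A point $(q,\varphi)$ (position $q\in Q$, velocity direction $\varphi\in\mathbf{S}^1$) is periodic if its trajectory returns at some time $T>0$ to position $q$ with direction $\varphi$. *)

(* Defs.v *)
From Stdlib Require Import Reals Lra Lia ZArith List.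
Open Scope R_scope.

Definition pt := (R * R)%type.

Definition padd (a b : pt) : pt := (fst a + fst b, snd a + snd b).
Definition psub (a b : pt) : pt := (fst a - fst b, snd a - snd b).
Definition pscale (r : R) (a : pt) : pt := (r * fst a, r * snd a).
Definition dot (a b : pt) : R := fst a * fst b + snd a * snd b.
Definition cross (a b : pt) : R := fst a * snd b - snd a * fst b.
Definition pnorm (a : pt) : R := sqrt (dot a a).

Definition refl (d u : pt) : pt :=
  psub (pscale (2 * dot u d / dot d d) d) u.

Definition vtx (n : nat) (v : nat -> pt) (i : nat) : pt := v (Nat.modulo i n).

Definition sidevec (n : nat) (v : nat -> pt) (i : nat) : pt :=
  psub (vtx n v (S i)) (vtx n v i).

(* v 0, ..., v (n-1) are the vertices, listed counterclockwise, of a convex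
   polygon (n >= 3): every vertex not on side i lies strictly to the left of
   the line of side i (so no three vertices are collinear). *)
Definition convex_polygon (n : nat) (v : nat -> pt) : Prop :=
  (3 <= n)%nat /\
  forall i j, (i < n)%nat -> (j < n)%nat -> j <> i -> j <> Nat.modulo (S i) n ->
    0 < cross (sidevec n v i) (psub (v j) (vtx n v i)).

Definition inQ (n : nat) (v : nat -> pt) (x : pt) : Prop :=
  forall i, (i < n)%nat -> 0 <= cross (sidevec n v i) (psub x (vtx n v i)).

Definition is_vertex (n : nat) (v : nat -> pt) (x : pt) : Prop :=
  exists k, (k < n)%nat /\ x = v k.

Definition rational_polygon (n : nat) (v : nat -> pt) : Prop :=
  forall i j, (i < n)%nat -> (j < n)%nat ->
    exists (p : Z) (m : nat), (0 < m)%nat /\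
      cos (IZR p * PI / INR m) * (pnorm (sidevec n v i) * pnorm (sidevec n v j))
      = dot (sidevec n v i) (sidevec n v j).

Definition on_side (n : nat) (v : nat -> pt) (i : nat) (x : pt) : Prop :=
  exists l, 0 < l < 1 /\ x = padd (vtx n v i) (pscale l (sidevec n v i)).

Definition in_open_cone (a b w : pt) : Prop :=
  exists s t, 0 < s /\ 0 < t /\ w = padd (pscale s a) (pscale t b).

(* Vertex rule ("continuation by continuity"): a trajectory with direction u
   reaching a vertex whose two sides point along e1, e2 (from the vertex) is
   continued as the limit of the nearby parallel trajectories that hit the
   side e1 first: they reflect in e1, then (if the reflected direction goes
   on to hit side e2 near the vertex) in e2, then in e1, ..., until they leave
   the corner; w is the final direction. *)
Inductive corner_exit : pt -> pt -> pt -> pt -> Prop :=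
| ce_stop e1 e2 u :
    ~ in_open_cone e2 (pscale (-1) e1) (refl e1 u) ->
    corner_exit e1 e2 u (refl e1 u)
| ce_step e1 e2 u w :
    in_open_cone e2 (pscale (-1) e1) (refl e1 u) ->
    corner_exit e2 e1 (refl e1 u) w ->
    corner_exit e1 e2 u w.

(* Bounce at the boundary point c: incoming direction u, outgoing w.
   [left] encodes the fixed orientation of the boundary: with [left = true]
   the trajectory through vertex k is continued as the limit of trajectories
   hitting the side preceding vertex k (in the counterclockwise order), with
   [left = false] the side following it. *)
Definition bounce (n : nat) (v : nat -> pt) (left : bool) (c u w : pt) : Prop :=
  (exists i, (i < n)%nat /\ on_side n v i c /\ w = refl (sidevec n v i) u) \/
  (exists k, (k < n)%nat /\ c = v k /\
     let ea := psub (vtx n v (k + n - 1)) (v k) in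
     let eb := psub (vtx n v (S k)) (v k) in
     if left then corner_exit ea eb u w else corner_exit eb ea u w).

Definition leg (n : nat) (v : nat -> pt) (x u : pt) (t : R) : Prop :=
  0 <= t /\
  (forall s, 0 <= s <= t -> inQ n v (padd x (pscale s u))) /\
  (forall s, t < s -> ~ inQ n v (padd x (pscale s u))).

Fixpoint sumR (t : nat -> R) (m : nat) : R :=
  match m with O => 0 | S m' => sumR t m' + t m' end.

Definition periodic_point (n : nat) (v : nat -> pt) (left : bool) (q u : pt) : Prop :=
  exists (m : nat) (x w : nat -> pt) (t : nat -> R) (s : R),
    x O = q /\ w O = u /\
    (forall k, (k < m)%nat ->
       leg n v (x k) (w k) (t k) /\
       x (S k) = padd (x k) (pscale (t k) (w k)) /\
       bounce n v left (x (S k)) (w k) (w (S k))) /\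
    0 <= s /\
    (forall r, 0 <= r <= s -> inQ n v (padd (x m) (pscale r (w m)))) /\
    padd (x m) (pscale s (w m)) = q /\ w m = u /\
    0 < sumR t m + s.

Definition unit_vec (u : pt) : Prop := dot u u = 1.

Definition Bset (n : nat) (v : nat -> pt) (left : bool) (q : pt) : Prop :=
  inQ n v q /\ ~ is_vertex n v q /\
  ~ (exists u, unit_vec u /\ periodic_point n v left q u).

Definition on_segment (a b x : pt) : Prop :=
  exists l, 0 <= l <= 1 /\ x = padd a (pscale l (psub b a)).

(* Main.v *)
Require Import Defs.
From Stdlib Require Import Reals Lra Lia Psatz ZArith List Classical.
Open Scope R_scope.

(** An oriented line is a pair (direction [w], offset [c]), and the billiard
    map acts on those lines that avoid the vertices.  By rationality only
    finitely many directions occur.  Fix a side and the direction [u]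
    perpendicular to it.  A trajectory that starts perpendicularly at the side
    and later hits it perpendicularly again retraces its way, so it is periodic.
    Since trajectories can be run backwards, each of the finitely many lines
    through a vertex is reached by at most one perpendicular trajectory that
    has not returned before.  A perpendicular trajectory that neither returns
    nor reaches a vertex would sit in an open band of parallel trajectories
    with the same itinerary; the images of the band are isometric in a bounded
    phase space, so two of them overlap, and injectivity forces a return.
    Hence all but finitely many feet on each side are good.  Every point of the
    polygon that is not a vertex has a foot on its nearest side, and in a
    triangle it has feet on two sides. *)

(** * Plane vectors and reflections *)

Ltac coords :=
  unfold cross, dot, psub, padd, pscale in *; simpl in *.

Lemma pt_eq (a b : pt) : fst a = fst b -> snd a = snd b -> a = b.
Proof. destruct a, b; simpl; congruence. Qed.

Lemma parallel_difference (w y z : pt) :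
  0 < dot w w -> cross w y = cross w z ->
  z = padd y (pscale (dot (psub z y) w / dot w w) w).
Proof.
  intros Hw E. set (s := dot (psub z y) w / dot w w).
  assert (Hs : s * dot w w = dot (psub z y) w) by (unfold s; field; lra).
  clearbody s. destruct w as [a b], y as [c d], z as [e f]; coords.
  apply pt_eq; simpl; apply Rmult_eq_reg_l with (a * a + b * b); try lra.
  - pose proof (f_equal (Rmult a) Hs). pose proof (f_equal (Rmult b) E). simpl in *; lra.
  - pose proof (f_equal (Rmult b) Hs). pose proof (f_equal (Rmult a) E). simpl in *; lra.
Qed.

Lemma cross_move (d x w a : pt) (s : R) :
  cross d (psub (padd x (pscale s w)) a) = cross d (psub x a) + s * cross d w.
Proof. coords; ring. Qed.

Lemma dot_pos (d : pt) : d <> (0, 0) -> 0 < dot d d.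
Proof.
  destruct d as [a b]; intro H; coords.
  destruct (Req_dec a 0) as [-> | Ha].
  - assert (b <> 0) by (intros ->; auto). nra.
  - nra.
Qed.

Lemma refl_refl (d u : pt) : 0 < dot d d -> refl d (refl d u) = u.
Proof.
  destruct d as [a b], u as [c e]; unfold refl; coords; intro H.
  apply pt_eq; simpl; field; lra.
Qed.

Lemma refl_opp (d u : pt) : refl d (pscale (-1) u) = pscale (-1) (refl d u).
Proof. destruct d as [a b], u as [c e]; unfold refl, Rdiv; coords; apply pt_eq; simpl; ring. Qed.

Lemma opp_opp (u : pt) : pscale (-1) (pscale (-1) u) = u.
Proof. destruct u; coords; apply pt_eq; simpl; ring. Qed.

Lemma succ_mod (n i : nat) : (i < n)%nat ->
  ((S i < n)%nat /\ Nat.modulo (S i) n = S i) \/ (S i = n /\ Nat.modulo (S i) n = 0%nat).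
Proof.
  intro H. destruct (Nat.eq_dec (S i) n) as [E | E].
  - right; split; auto. rewrite E. apply Nat.Div0.mod_same.
  - left; split; [lia | apply Nat.mod_small; lia].
Qed.

(** * Billiard map on oriented lines *)

(* An oriented line in direction [w] is encoded by its offset [c]: it is
   [{x | cross w x = c}].  It leaves the polygon through the open side [j]
   exactly when [c] lies strictly between the offsets of the two endpoints,
   in increasing order; it enters through [j] when the order is decreasing. *)
Definition exits (n : nat) (v : nat -> pt) (w : pt) (c : R) (j : nat) : Prop :=
  cross w (vtx n v j) < c < cross w (vtx n v (S j)).

Definition enters (n : nat) (v : nat -> pt) (w : pt) (c : R) (j : nat) : Prop :=
  cross w (vtx n v (S j)) < c < cross w (vtx n v j).

(** The offset of the reflected line: [cross (sidevec n v j) x] is constant along side [j], which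
    makes the offset after the bounce an affine function of [c]. Its slope is -1, so a bounce acts
    on parallel lines as an isometry. *)
Definition bounced_offset (n : nat) (v : nat -> pt) (j : nat) (w : pt) (c : R) : R :=
  2 * (dot w (sidevec n v j) / dot (sidevec n v j) (sidevec n v j))
    * cross (sidevec n v j) (vtx n v j) - c.

(** The index counts reflections. Positions are forgotten, and every reflection takes place in an
    open side, so a path stops before a vertex. *)
Inductive path (n : nat) (v : nat -> pt) : nat -> pt -> R -> pt -> R -> Prop :=
| path_nil w c : path n v 0 w c w c
| path_snoc k w c w1 c1 j :
    path n v k w c w1 c1 -> (j < n)%nat -> exits n v w1 c1 j ->
    path n v (S k) w c (refl (sidevec n v j) w1) (bounced_offset n v j w1 c1).

Section Polygon.

Context (n : nat) (v : nat -> pt) (cp : convex_polygon n v).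

Local Notation V := (vtx n v).
Local Notation D := (sidevec n v).

Lemma n_ge3 : (3 <= n)%nat.
Proof. apply cp. Qed.

Lemma vtx_small j : (j < n)%nat -> V j = v j.
Proof. intro H. unfold vtx. rewrite Nat.mod_small; auto. Qed.

Lemma vtx_mod j : V (Nat.modulo j n) = V j.
Proof. unfold vtx. rewrite Nat.Div0.mod_mod. reflexivity. Qed.

Lemma vtx_S_mod j : V (S (Nat.modulo j n)) = V (S j).
Proof.
  unfold vtx. f_equal.
  rewrite <- (Nat.add_1_l (Nat.modulo j n)), <- (Nat.add_1_l j).
  apply Nat.Div0.add_mod_idemp_r.
Qed.

Lemma vtx_left i j : (i < n)%nat -> (j < n)%nat -> j <> i -> j <> Nat.modulo (S i) n ->
  0 < cross (D i) (psub (V j) (V i)).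
Proof. intros Hi Hj H1 H2. rewrite (vtx_small j Hj). apply cp; auto. Qed.

Lemma vtx_inQ i j : (i < n)%nat -> (j < n)%nat -> 0 <= cross (D i) (psub (V j) (V i)).
Proof.
  intros Hi Hj.
  destruct (Nat.eq_dec j i) as [-> | H1]; [coords; lra |].
  destruct (Nat.eq_dec j (Nat.modulo (S i) n)) as [-> | H2].
  - rewrite vtx_mod. unfold sidevec. coords; lra.
  - left. apply vtx_left; auto.
Qed.

Lemma mod_lt j : (Nat.modulo j n < n)%nat.
Proof. apply Nat.mod_upper_bound. pose proof n_ge3; lia. Qed.

Lemma sidevec_mod j : D (Nat.modulo j n) = D j.
Proof. unfold sidevec. rewrite vtx_mod, vtx_S_mod. reflexivity. Qed.

(** Vertex [i + 2] differs from both ends of side [i] because [n >= 3], so it lies strictly to the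
    left, and its difference from vertex [i] is [D i] plus [D (S i)]. *)
Lemma cross_consecutive i : (i < n)%nat -> 0 < cross (D i) (D (S i)).
Proof.
  intro Hi.
  assert (H : 0 < cross (D i) (psub (V (Nat.modulo (S (S i)) n)) (V i))).
  { apply vtx_left; auto using mod_lt; pose proof n_ge3;
    rewrite <- (Nat.add_1_l (S i)), <- Nat.Div0.add_mod_idemp_r; simpl;
    pose proof (mod_lt (S i)) as Hm;
    destruct (succ_mod n i Hi) as [[? E] | [? E]]; rewrite E in *;
    destruct (succ_mod n _ Hm) as [[? E'] | [? E']]; rewrite E'; lia. }
  rewrite vtx_mod in H. unfold sidevec in *. coords; lra.
Qed.

Lemma dot_sidevec_pos i : (i < n)%nat -> 0 < dot (D i) (D i).
Proof.
  intro Hi. apply dot_pos. intro E. pose proof (cross_consecutive i Hi) as H.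
  rewrite E in H. coords; lra.
Qed.

(** The cross product with [D i] is affine along side [j], nonnegative at both ends and positive at
    one of them: the far end if [j] follows [i], the near end otherwise. *)
Lemma on_side_left j i x : (j < n)%nat -> (i < n)%nat -> i <> j -> on_side n v j x ->
  0 < cross (D i) (psub x (V i)).
Proof.
  intros Hj Hi Hij (l & Hl & ->).
  assert (E : cross (D i) (psub (padd (V j) (pscale l (D j))) (V i)) =
    (1 - l) * cross (D i) (psub (V j) (V i))
    + l * cross (D i) (psub (V (Nat.modulo (S j) n)) (V i))).
  { rewrite vtx_mod. unfold sidevec. coords; ring. }
  rewrite E; clear E.
  pose proof (vtx_inQ i j Hi Hj) as H1.
  pose proof (vtx_inQ i _ Hi (mod_lt (S j))) as H2.
  destruct (Nat.eq_dec j (Nat.modulo (S i) n)) as [Ej | Ej].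
  - assert (H3 : 0 < cross (D i) (psub (V (Nat.modulo (S j) n)) (V i))).
    { apply vtx_left; auto using mod_lt; pose proof n_ge3;
      destruct (succ_mod n i Hi) as [[? E] | [? E]]; rewrite E in *;
      destruct (succ_mod n j Hj) as [[? E'] | [? E']]; rewrite E'; lia. }
    nra.
  - assert (H3 : 0 < cross (D i) (psub (V j) (V i))) by (apply vtx_left; auto).
    nra.
Qed.

Lemma on_side_inQ j x : (j < n)%nat -> on_side n v j x -> inQ n v x.
Proof.
  intros Hj Hx i Hi. destruct (Nat.eq_dec i j) as [-> | Hij].
  - destruct Hx as (l & _ & ->). coords; lra.
  - left. apply (on_side_left j); auto.
Qed.

(** The intersection of the line with side [j], found by interpolating between the offsets of the
    two endpoints. *)
Definition exit_pt (j : nat) (w : pt) (c : R) : pt :=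
  padd (V j) (pscale ((c - cross w (V j)) / (cross w (V (S j)) - cross w (V j))) (D j)).

Lemma exit_pt_side j w c : exits n v w c j -> on_side n v j (exit_pt j w c).
Proof.
  intros [H1 H2]. eexists; split; [| reflexivity].
  assert (H : 0 < cross w (V (S j)) - cross w (V j)) by lra.
  split.
  - apply Rdiv_lt_0_compat; lra.
  - apply Rmult_lt_reg_r with (1 := H). unfold Rdiv.
    rewrite Rmult_assoc, Rinv_l; lra.
Qed.

Lemma exit_pt_offset j w c : exits n v w c j -> cross w (exit_pt j w c) = c.
Proof.
  intros [H1 H2]. unfold exit_pt.
  transitivity (cross w (V j) + (c - cross w (V j)) / (cross w (V (S j)) - cross w (V j))
     * (cross w (V (S j)) - cross w (V j))).
  - unfold sidevec. set (l := _ / _). coords; ring.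
  - field. lra.
Qed.

Lemma exits_outward j w c : exits n v w c j -> cross (D j) w < 0.
Proof. intros [H1 H2]. unfold sidevec. coords; lra. Qed.

Lemma exits_dir_pos j w c : exits n v w c j -> 0 < dot w w.
Proof.
  intro H. apply dot_pos. intros ->. apply exits_outward in H. coords; lra.
Qed.

(** Both exit points lie on the same line, and each is strictly on the inner side of the other's
    side. As [w] points outward at both sides, each would have to come strictly before the other. *)
Lemma exits_unique w c j i :
  (j < n)%nat -> (i < n)%nat -> exits n v w c j -> exits n v w c i -> j = i.
Proof.
  intros Hj Hi Ej Ei. apply NNPP; intro N.
  pose proof (on_side_left j i _ Hj Hi (not_eq_sym N) (exit_pt_side _ _ _ Ej)) as H1.
  pose proof (on_side_left i j _ Hi Hj N (exit_pt_side _ _ _ Ei)) as H2.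
  pose proof (parallel_difference w (exit_pt j w c) (exit_pt i w c)) as Hs.
  specialize (Hs (exits_dir_pos _ _ _ Ej)).
  rewrite !exit_pt_offset in Hs by auto. specialize (Hs eq_refl).
  set (s := _ / _) in Hs. clearbody s.
  destruct (exit_pt_side _ _ _ Ei) as (l & _ & Hl).
  destruct (exit_pt_side _ _ _ Ej) as (l' & _ & Hl').
  assert (Zi : cross (D i) (psub (exit_pt i w c) (V i)) = 0) by (rewrite Hl; coords; ring).
  assert (Zj : cross (D j) (psub (exit_pt j w c) (V j)) = 0) by (rewrite Hl'; coords; ring).
  rewrite Hs, cross_move in Zi, H2.
  apply exits_outward in Ej, Ei. nra.
Qed.

Lemma enters_opp w c j : enters n v w c j <-> exits n v (pscale (-1) w) (- c) j.
Proof.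
  unfold enters, exits.
  assert (E : forall x, cross (pscale (-1) w) x = - cross w x) by (intro; coords; ring).
  rewrite !E. lra.
Qed.

Lemma enters_unique w c j i :
  (j < n)%nat -> (i < n)%nat -> enters n v w c j -> enters n v w c i -> j = i.
Proof. rewrite !enters_opp. apply exits_unique. Qed.

Lemma cross_refl j w x :
  cross (D j) x = cross (D j) (V j) ->
  cross (refl (D j) w) x =
    2 * (dot w (D j) / dot (D j) (D j)) * cross (D j) (V j) - cross w x.
Proof. intro E. rewrite <- E. unfold refl, Rdiv. coords. ring. Qed.

Lemma cross_side j : cross (D j) (V (S j)) = cross (D j) (V j).
Proof. unfold sidevec. coords; ring. Qed.

Lemma bounce_enters j w c :
  exits n v w c j -> enters n v (refl (D j) w) (bounced_offset n v j w c) j.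
Proof.
  unfold exits, enters, bounced_offset. intro H.
  rewrite !cross_refl by (try apply cross_side; reflexivity). lra.
Qed.

Lemma bounced_offset_invol j w c : (j < n)%nat ->
  bounced_offset n v j (refl (D j) w) (bounced_offset n v j w c) = c.
Proof.
  intro Hj. unfold bounced_offset.
  assert (E : dot (refl (D j) w) (D j) = dot w (D j)).
  { pose proof (dot_sidevec_pos j Hj) as H. revert H.
    unfold refl. destruct (D j) as [a b], w as [e f]. coords. intro. field. lra. }
  rewrite E. ring.
Qed.

Lemma bounced_offset_opp j w c :
  bounced_offset n v j (pscale (-1) w) (- c) = - bounced_offset n v j w c.
Proof. unfold bounced_offset, Rdiv. coords; ring. Qed.

(** * Composition, reversal and determinism of paths *)

Lemma path_trans k l w c w1 c1 w2 c2 :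
  path n v k w c w1 c1 -> path n v l w1 c1 w2 c2 -> path n v (k + l) w c w2 c2.
Proof.
  intros P Q. revert P. induction Q; intro P.
  - rewrite Nat.add_0_r. exact P.
  - rewrite Nat.add_succ_r. constructor; auto.
Qed.

(** The reversed last bounce is itself a bounce, since the line that enters through [j] exits
    through [j] when its direction is reversed. It is put in front of the reversed rest. *)
Lemma path_reverse k w c w1 c1 :
  path n v k w c w1 c1 -> path n v k (pscale (-1) w1) (- c1) (pscale (-1) w) (- c).
Proof.
  induction 1.
  - constructor.
  - change (S k) with (1 + k)%nat. eapply path_trans; [| exact IHpath].
    replace (pscale (-1) w1) with (refl (D j) (pscale (-1) (refl (D j) w1))).
    2: { rewrite refl_opp, refl_refl; auto using dot_sidevec_pos. }
    replace (- c1) with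
      (bounced_offset n v j (pscale (-1) (refl (D j) w1)) (- bounced_offset n v j w1 c1)).
    2: { rewrite bounced_offset_opp, bounced_offset_invol; auto. }
    constructor; auto; [constructor |].
    apply enters_opp. apply bounce_enters; auto.
Qed.

Lemma path_split k l w c w2 c2 :
  path n v (k + l) w c w2 c2 -> exists w1 c1, path n v k w c w1 c1 /\ path n v l w1 c1 w2 c2.
Proof.
  revert w2 c2. induction l; intros w2 c2 P.
  - rewrite Nat.add_0_r in P. exists w2, c2; split; [auto | constructor].
  - rewrite Nat.add_succ_r in P. inversion P; subst.
    edestruct IHl as (w1' & c1' & P1 & P2); eauto.
    exists w1', c1'; split; auto. constructor; auto.
Qed.

Lemma path_det k w c w1 c1 w2 c2 :
  path n v k w c w1 c1 -> path n v k w c w2 c2 -> w1 = w2 /\ c1 = c2.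
Proof.
  intro P. revert w2 c2. induction P; intros w2 c2 Q; inversion Q; subst; auto.
  edestruct IHP as [E1 E2]; eauto. subst.
  replace j0 with j; auto. eapply exits_unique; eauto.
Qed.

Lemma path_det_back k w c w1 c1 w2 c2 :
  path n v k w1 c1 w c -> path n v k w2 c2 w c -> w1 = w2 /\ c1 = c2.
Proof.
  intros P Q. apply path_reverse in P, Q.
  destruct (path_det _ _ _ _ _ _ _ P Q) as [E1 E2]. split; [| lra].
  rewrite <- (opp_opp w1), E1, opp_opp. reflexivity.
Qed.

(** The form in which injectivity of the billiard map is used: common final stretches can be cut
    off. *)
Lemma path_cancel k l w c w1 c1 w2 c2 :
  path n v k w1 c1 w c -> path n v (l + k) w2 c2 w c -> path n v l w2 c2 w1 c1.
Proof.
  intros P Q. apply path_split in Q. destruct Q as (w3 & c3 & Q1 & Q2).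
  destruct (path_det_back _ _ _ _ _ _ _ P Q2) as [-> ->]. exact Q1.
Qed.

(* Read cyclically, the vertex offsets pass below [c] at the entry side, so
   they must pass above it somewhere else. *)
Lemma offsets_cross_up w c i :
  (i < n)%nat -> enters n v w c i ->
  exists j, (j < n)%nat /\ cross w (V j) < c <= cross w (V (S j)).
Proof.
  intros Hi [H1 H2].
  assert (A : forall k, (exists j, cross w (V j) < c <= cross w (V (S j))) \/
    cross w (V (S i + k)) < c).
  { induction k.
    - right. rewrite Nat.add_0_r. auto.
    - destruct IHk as [? | Hk]; auto.
      destruct (Rlt_le_dec (cross w (V (S i + S k))) c); auto.
      left. exists (S i + k)%nat. rewrite Nat.add_succ_r in r. auto. }
  destruct (A (n - 1)%nat) as [(j & Hj) | Hk].
  - exists (Nat.modulo j n). rewrite vtx_mod, vtx_S_mod. auto using mod_lt.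
  - replace (S i + (n - 1))%nat with (i + 1 * n)%nat in Hk by lia.
    unfold vtx in Hk at 1. rewrite Nat.Div0.mod_add in Hk. fold (V i) in Hk. lra.
Qed.

Lemma exit_or_singular w c i :
  (i < n)%nat -> enters n v w c i ->
  (exists j, (j < n)%nat /\ exits n v w c j) \/
  (exists r, (r < n)%nat /\ c = cross w (V r)).
Proof.
  intros Hi H. destruct (offsets_cross_up _ _ _ Hi H) as (j & Hj & H1 & [H2 | H2]).
  - left. exists j. split; auto. split; auto.
  - right. exists (Nat.modulo (S j) n). rewrite vtx_mod. auto using mod_lt.
Qed.

End Polygon.

(** * Recurrence of perpendicular trajectories *)

(** Each key accounts for at most one element. [Rl] is a mere relation, so an element may own
    several keys and none has to be computed. *)
Lemma finite_of_injective_keys (A K : Type) (Rl : A -> K -> Prop) (keys : list K)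
  (P : A -> Prop) :
  (forall a, P a -> exists k, In k keys /\ Rl a k) ->
  (forall a b k, P a -> P b -> Rl a k -> Rl b k -> a = b) ->
  exists l, forall a, P a -> In a l.
Proof.
  revert P. induction keys as [| k ks IH]; intros P Hk Hinj.
  - exists nil. intros a Ha. destruct (Hk a Ha) as (k & [] & _).
  - destruct (IH (fun a => P a /\ exists k', In k' ks /\ Rl a k')) as [l Hl].
    { intros a [_ Ha]; auto. }
    { intros a b k' [Ha _] [Hb _]; eauto. }
    destruct (classic (exists a, P a /\ Rl a k)) as [(a0 & Ha0 & R0) | N].
    + exists (a0 :: l). intros a Ha. destruct (Hk a Ha) as (k' & [<- | Hin] & Hr).
      * left. eauto.
      * right. eauto.
    + exists l. intros a Ha. destruct (Hk a Ha) as (k' & [<- | Hin] & Hr); eauto.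
      exfalso; eauto.
Qed.

Lemma pigeonhole (K : Type) (Rl : nat -> K -> Prop) (keys : list K) :
  (forall a, exists k, In k keys /\ Rl a k) ->
  exists a b k, (a < b)%nat /\ Rl a k /\ Rl b k.
Proof.
  intro H. apply NNPP; intro N.
  destruct (finite_of_injective_keys nat K Rl keys (fun _ => True)) as [l Hl]; auto.
  - intros a b k _ _ Ha Hb. destruct (Nat.lt_total a b) as [L | [-> | L]]; auto;
    exfalso; apply N; eauto 6.
  - assert (B : forall x, In x l -> (x <= list_max l)%nat).
    { apply Forall_forall. apply list_max_le. reflexivity. }
    specialize (B (S (list_max l)) (Hl _ I)). lia.
Qed.

Lemma list_bounded (l : list R) : exists M, forall x, In x l -> Rabs x <= M.
Proof.
  induction l as [| a l [M HM]].
  - exists 0. intros x [].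
  - exists (Rmax (Rabs a) M). intros x [<- | Hx].
    + apply Rmax_l.
    + eapply Rle_trans; [apply HM; auto | apply Rmax_r].
Qed.

Lemma list_separated (l : list R) (c : R) : ~ In c l ->
  exists e, 0 < e /\ forall x, In x l -> e <= Rabs (x - c).
Proof.
  induction l as [| a l IH]; intro H.
  - exists 1. split; [lra | intros x []].
  - destruct IH as (e & He & Hl); [intro; apply H; right; auto |].
    assert (0 < Rabs (a - c)) by (apply Rabs_pos_lt; intro; apply H; left; lra).
    exists (Rmin e (Rabs (a - c))). split; [apply Rmin_pos; auto |].
    intros x [<- | Hx]; [apply Rmin_r |].
    eapply Rle_trans; [apply Rmin_l | auto].
Qed.

Lemma cell (e x : R) (K : nat) : 0 < e -> 0 <= x < INR K * e ->
  exists m, (m < K)%nat /\ INR m * e <= x < INR m * e + e.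
Proof.
  intros He. induction K as [| K IH]; intro Hx.
  - simpl in Hx; lra.
  - destruct (Rlt_le_dec x (INR K * e)) as [L | L].
    + destruct IH as (m & Hm & H); [lra | exists m; split; [lia | auto]].
    + exists K. rewrite S_INR in Hx. split; [lia | lra].
Qed.

Section Recurrence.

Context (n : nat) (v : nat -> pt) (cp : convex_polygon n v).
Context (i : nat) (Hi : (i < n)%nat) (u : pt).

Local Notation V := (vtx n v).
Local Notation D := (sidevec n v).

(** A second departure from side [i] in direction [u] after between 1 and [k] bounces. The offset
    [c'] may differ from [c]; that the orbit closes up is a consequence drawn below. *)
Definition returns_by (k : nat) (c : R) : Prop :=
  exists l c', (l < k)%nat /\ path n v (S l) u c u c' /\ enters n v u c' i.

(* After the perpendicular return the trajectory retraces its way. *)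
Lemma closed_of_returns k c :
  refl (D i) u = pscale (-1) u -> enters n v u c i -> returns_by k c ->
  exists m, path n v (S m) u c u c.
Proof.
  intros Hperp Hc (l & c' & _ & P & Ec').
  (* A perpendicular hit sends the line back along itself: [u] is orthogonal to [D i], so the first
     term of [bounced_offset] vanishes. *)
  assert (last : forall c, enters n v u c i ->
     path n v 1 (pscale (-1) u) (- c) u c).
  { intros b Eb. pose proof (dot_sidevec_pos n v cp i Hi) as Hd.
    assert (Hop : refl (D i) (pscale (-1) u) = u) by (rewrite refl_opp, Hperp; apply opp_opp).
    replace u with (refl (D i) (pscale (-1) u)) at 2 by exact Hop.
    replace b with (bounced_offset n v i (pscale (-1) u) (- b)) at 2.
    - constructor; auto; [constructor | apply enters_opp; auto].
    - unfold bounced_offset.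
      replace (dot (pscale (-1) u) (D i)) with 0; [unfold Rdiv; ring |].
      revert Hd Hop. destruct u as [a1 a2]. destruct (D i) as [d1 d2].
      unfold refl. coords. intros Hd Hop. injection Hop as H1 H2.
      set (t := 2 * _ / _) in *.
      assert (Ht : t * (d1 * d1 + d2 * d2) = 2 * (-1 * a1 * d1 + -1 * a2 * d2))
        by (unfold t; field; lra).
      assert (T1 : t * d1 = 0) by lra. assert (T2 : t * d2 = 0) by lra.
      replace (t * (d1 * d1 + d2 * d2)) with (t * d1 * d1 + t * d2 * d2) in Ht by ring.
      rewrite T1, T2 in Ht. lra. }
  replace (S l) with (l + 1)%nat in P by lia.
  (* Without its last bounce the path arrives at side [i] along [pscale (-1) u]. Reversing this part
     leads from the foot of [c'] back to side [i] on the line of [c], and one more perpendicular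
     bounce closes the orbit. *)
  pose proof (path_cancel n v cp _ _ _ _ _ _ _ _ (last c' Ec') P) as P1.
  pose proof (path_reverse n v cp _ _ _ _ _ P1) as P2.
  rewrite opp_opp, Ropp_involutive in P2.
  exists (l + 1 + l)%nat.
  replace (S (l + 1 + l)) with ((l + 1) + (l + 1))%nat by lia.
  eapply path_trans; [exact P |].
  eapply path_trans; [exact P2 | auto].
Qed.

Context (W : list pt) (Hu : In u W)
  (W_refl : forall w j, In w W -> (j < n)%nat -> In (refl (D j) w) W).

Lemma path_dir k w c w1 c1 : In w W -> path n v k w c w1 c1 -> In w1 W.
Proof. induction 2; auto. Qed.

(** Feet whose trajectory comes onto a line through a vertex without an earlier perpendicular
    return. *)
Definition exceptional (c : R) : Prop :=
  enters n v u c i /\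
  exists k w r, (r < n)%nat /\ path n v k u c w (cross w (V r)) /\ ~ returns_by k c.

(** The key of a foot is the line through a vertex that it reaches, given by a direction in [W] and
    a vertex. Two feet with the same key coincide, or the longer orbit passes through the start of
    the shorter one and has thus returned. *)
Lemma exceptional_finite : exists l, forall c, exceptional c -> In c l.
Proof.
  apply finite_of_injective_keys with
    (Rl := fun c p => exists k, path n v k u c (fst p) (cross (fst p) (V (snd p))) /\
                        ~ returns_by k c)
    (keys := list_prod W (seq 0 n)).
  - intros c (_ & k & w & r & Hr & P & N). exists (w, r). split; eauto.
    apply in_prod; [eapply path_dir; eauto |]. apply in_seq; lia.
  - intros a b [w r] Ha Hb (k & Pa & Na) (l & Pb & Nb). simpl in *.
    (* If one orbit is longer, its first part leads from [u] back to [u]. *)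
    assert (T : forall a b k d, enters n v u a i ->
      path n v k u a w (cross w (V r)) -> path n v (S d + k) u b w (cross w (V r)) ->
      returns_by (S d + k) b).
    { intros a' b' k' d Ia Pa' Pb'. exists d, a'. repeat split; try lia; try apply Ia.
      eapply path_cancel; eauto. }
    destruct Ha as [Ha _], Hb as [Hb _].
    destruct (Nat.lt_total k l) as [L | [<- | L]].
    + exfalso. apply Nb. replace l with (S (l - S k) + k)%nat in * by lia. eauto.
    + eapply path_det_back; eauto.
    + exfalso. apply Na. replace k with (S (k - S l) + l)%nat in * by lia. eauto.
Qed.

(** By contradiction: without a return the orbit of [c] goes on forever, and a band of fixed width
    around it moves rigidly through a bounded set of lines. *)
Lemma returns_of_not_exceptional (exc : list R) (c : R) :
  (forall b, exceptional b -> In b exc) ->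
  enters n v u c i -> ~ In c exc -> exists k, returns_by k c.
Proof.
  intros Hexc Hc Nc. apply NNPP; intro NR.
  assert (forever : forall k, exists w1 c1, path n v k u c w1 c1 /\
            exists j, (j < n)%nat /\ enters n v w1 c1 j).
  { induction k as [| k (w1 & c1 & P & j & Hj & E)].
    - exists u, c. split; [constructor | eauto].
    - destruct (exit_or_singular n v cp _ _ _ Hj E) as [(j' & Hj' & X) | (r & Hr & ->)].
      + do 2 eexists. split; [econstructor; eauto |]. eauto using bounce_enters.
      + exfalso. apply Nc, Hexc. split; auto.
        exists k, w1, r. repeat split; auto. intro; apply NR; eauto. }
  (* The half-width [e] keeps the band inside side [i] and free of exceptional offsets. *)
  destruct (list_separated (cross u (V i) :: cross u (V (S i)) :: exc) c) as (e & He & Hsep).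
  { destruct Hc as [? ?]. intros [? | [? | ?]]; auto; lra. }
  assert (near : forall x, Rabs x < e -> enters n v u (c + x) i /\ ~ exceptional (c + x)).
  { intros x Hx.
    assert (N : forall y, In y (cross u (V i) :: cross u (V (S i)) :: exc) ->
              e <= Rabs (y - c)) by auto.
    pose proof (N (cross u (V i)) ltac:(simpl; auto)) as N1.
    pose proof (N (cross u (V (S i))) ltac:(simpl; auto)) as N2.
    destruct Hc as [Hc1 Hc2]. split.
    - revert Hx N1 N2. unfold enters, Rabs. repeat destruct Rcase_abs; lra.
    - intro X. specialize (N (c + x) ltac:(simpl; auto)).
      replace (c + x - c) with x in N by ring. lra. }
  (* All lines of the band share the itinerary of the centre, and [s] records whether the band is
     flipped. The claim covers all [l <= k] because the next step looks back at earlier times. *)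
  assert (band : forall k l, (l <= k)%nat -> forall w1 c1, path n v l u c w1 c1 ->
     exists s j, (s = 1 \/ s = -1) /\ (j < n)%nat /\ forall x, Rabs x < e ->
       path n v l u (c + x) w1 (c1 + s * x) /\ enters n v w1 (c1 + s * x) j).
  { induction k as [| k IH]; intros l Hl w1 c1 P.
    { replace l with 0%nat in * by lia. inversion P; subst.
      exists 1, i. repeat split; auto; rewrite Rmult_1_l; try constructor; apply near; auto. }
    destruct (Nat.eq_dec l (S k)) as [-> | Hne]; [| apply IH; auto; lia].
    inversion P as [| k' w' c' w0 c0 j P0 Hj X]; subst.
    destruct (IH k (Nat.le_refl _) _ _ P0) as (s & j0 & Hs & Hj0 & A).
    (* A neighbour that meets a vertex is not exceptional, so it returned earlier. At that time the
       centre has the same direction and entry side, hence it returned too. *)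
    assert (nonsing : forall x r, Rabs x < e -> (r < n)%nat -> c0 + s * x <> cross w0 (V r)).
    { intros x r Hx Hr Eq. destruct (A x Hx) as [Px _]. rewrite Eq in Px.
      destruct (near x Hx) as [Ix Nx].
      destruct (classic (returns_by k (c + x))) as [(l & c'' & Hlk & Pl & Il) | Nr].
      - destruct (forever (S l)) as (w2 & c2 & P2 & _).
        destruct (IH (S l) Hlk _ _ P2) as (s2 & j2 & _ & Hj2 & A2).
        destruct (A2 x Hx) as [P2x E2x].
        destruct (path_det n v cp _ _ _ _ _ _ _ P2x Pl) as [-> E2].
        rewrite E2 in E2x. assert (j2 = i) by (eapply enters_unique; eauto). subst.
        apply NR. exists (S l), l, c2. repeat split; auto.
        all: destruct (A2 0) as [_ E0]; [rewrite Rabs_R0; auto |];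
          rewrite Rmult_0_r, Rplus_0_r in E0; apply E0.
      - apply Nx. split; auto. exists k, w0, r. auto. }
    assert (Xx : forall x, Rabs x < e -> exits n v w0 (c0 + s * x) j).
    { (* otherwise an intermediate offset is singular *)
      assert (Z : forall y, 0 <= y < e \/ - e < y <= 0 -> Rabs y < e).
      { intro y. unfold Rabs. destruct Rcase_abs; lra. }
      intros x Hx.
      assert (Hx' : -e < x < e) by (revert Hx; unfold Rabs; destruct Rcase_abs; lra).
      assert (NS : forall r, (r < n)%nat -> forall y,
         Rmin 0 x <= y <= Rmax 0 x -> c0 + s * y <> cross w0 (V r)).
      { intros r Hr y Hy. apply nonsing; auto. apply Z. revert Hy.
        unfold Rmin, Rmax. repeat destruct Rle_dec; lra. }
      pose proof (NS j Hj) as NS1.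
      pose proof (NS _ (mod_lt n v cp (S j))) as NS2. rewrite vtx_mod in NS2.
      destruct X as [X1 X2].
      split; apply Rnot_le_lt; intro Le.
      (* The displacement at which the band would meet the vertex; it solves the equation because
         [s * s = 1]. *)
      - apply (NS1 (s * (cross w0 (V j) - c0))).
        + unfold Rmin, Rmax. destruct Hs as [-> | ->]; repeat destruct Rle_dec; lra.
        + destruct Hs as [-> | ->]; lra.
      - apply (NS2 (s * (cross w0 (V (S j)) - c0))).
        + unfold Rmin, Rmax. destruct Hs as [-> | ->]; repeat destruct Rle_dec; lra.
        + destruct Hs as [-> | ->]; lra. }
    exists (- s), j. repeat split; auto.
    - destruct Hs; [right | left]; lra.
    - replace (bounced_offset n v j w0 c0 + - s * x)
        with (bounced_offset n v j w0 (c0 + s * x)) by (unfold bounced_offset; ring).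
      constructor; auto. apply A; auto.
    - replace (bounced_offset n v j w0 c0 + - s * x)
        with (bounced_offset n v j w0 (c0 + s * x)) by (unfold bounced_offset; ring).
      apply bounce_enters; auto.
    - replace (bounced_offset n v j w0 c0 + - s * x)
        with (bounced_offset n v j w0 (c0 + s * x)) by (unfold bounced_offset; ring).
      apply bounce_enters; auto. }
  (* [M] bounds the offsets of all vertices for all directions in [W], hence every offset along the
     orbit. *)
  destruct (list_bounded (map (fun p => cross (fst p) (V (snd p))) (list_prod W (seq 0 n))))
    as [M HM].
  assert (bounded : forall k w1 c1, path n v k u c w1 c1 -> - M <= c1 <= M).
  { intros k w1 c1 P. destruct (forever k) as (w2 & c2 & P2 & j & Hj & E1 & E2).
    destruct (path_det n v cp _ _ _ _ _ _ _ P P2) as [<- <-].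
    assert (B : forall r, (r < n)%nat -> Rabs (cross w1 (V r)) <= M).
    { intros r Hr. apply HM. apply in_map_iff. exists (w1, r). split; auto.
      apply in_prod; [eapply path_dir; eauto | apply in_seq; lia]. }
    pose proof (B j Hj) as B1. pose proof (B _ (mod_lt n v cp (S j))) as B2.
    rewrite vtx_mod in B2. revert B1 B2. unfold Rabs. repeat destruct Rcase_abs; lra. }
  destruct (INR_archimed e (2 * M + 1) He) as [K HK].
  (* The keys are pairs of a direction and a cell of length [e]: at two times [a < b] the lines are
     parallel and less than [e] apart. *)
  destruct (pigeonhole (pt * nat)
    (fun k p => exists c1, path n v k u c (fst p) c1 /\
       INR (snd p) * e <= c1 + M < INR (snd p) * e + e)
    (list_prod W (seq 0 K))) as (a & b & [w m] & Hab & (ca & Pa & Ma) & (cb & Pb & Mb)).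
  { intro k. destruct (forever k) as (w1 & c1 & P & _). pose proof (bounded _ _ _ P).
    destruct (cell e (c1 + M) K He) as (m & Hm & Hc1); [lra |].
    exists (w1, m). split; eauto. apply in_prod; [eapply path_dir; eauto | apply in_seq; lia]. }
  simpl in *.
  destruct (band b b (Nat.le_refl _) _ _ Pb) as (s & j & Hs & _ & A).
  (* The neighbour at displacement [x] is at time [b] where the centre is at time [a]. Cancelling
     [a] bounces puts it on the initial line of the centre at time [b - a], which is a return, and
     the band carries this return over to the centre. *)
  set (x := s * (ca - cb)).
  assert (Hx : Rabs x < e).
  { unfold x, Rabs. destruct Hs as [-> | ->]; destruct Rcase_abs; lra. }
  destruct (A x Hx) as [Pbx _].
  replace (cb + s * x) with ca in Pbx by (unfold x; destruct Hs as [-> | ->]; ring).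
  replace b with (S (b - S a) + a)%nat in Pbx by lia.
  pose proof (path_cancel n v cp _ _ _ _ _ _ _ _ Pa Pbx) as Px.
  destruct (forever (S (b - S a))) as (w2 & c2 & P2 & _).
  destruct (band _ _ (Nat.le_refl _) _ _ P2) as (s2 & j2 & _ & Hj2 & A2).
  destruct (A2 x Hx) as [P2x E2x].
  destruct (path_det n v cp _ _ _ _ _ _ _ P2x Px) as [-> E2].
  rewrite E2 in E2x. assert (j2 = i) by (eapply enters_unique; eauto). subst.
  destruct (A2 0) as [_ E0]; [rewrite Rabs_R0; auto |].
  rewrite Rmult_0_r, Rplus_0_r in E0.
  apply NR. exists (S (b - S a)), (b - S a)%nat, c2. auto.
Qed.

End Recurrence.

(** * Closed paths and periodic points *)

Section Periodicity.

Context (n : nat) (v : nat -> pt) (cp : convex_polygon n v).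

Local Notation V := (vtx n v).
Local Notation D := (sidevec n v).

(** Unrolls a path into sequences, the form that [periodic_point] asks for. *)
Lemma path_states k w c w1 c1 : path n v k w c w1 c1 ->
  exists (ws : nat -> pt) (cs : nat -> R) (js : nat -> nat),
    ws 0%nat = w /\ cs 0%nat = c /\ ws k = w1 /\ cs k = c1 /\
    forall l, (l < k)%nat -> (js l < n)%nat /\ exits n v (ws l) (cs l) (js l) /\
      ws (S l) = refl (D (js l)) (ws l) /\
      cs (S l) = bounced_offset n v (js l) (ws l) (cs l).
Proof.
  induction 1 as [w c | k w c w1 c1 j P (ws & cs & js & E1 & E2 & E3 & E4 & IH) Hj X].
  - exists (fun _ => w), (fun _ => c), (fun _ => 0%nat). repeat split; auto; lia.
  - exists (fun l => if (l <=? k)%nat then ws l else refl (D j) w1),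
      (fun l => if (l <=? k)%nat then cs l else bounced_offset n v j w1 c1),
      (fun l => if (l <? k)%nat then js l else j).
    assert (F : (S k <=? k)%nat = false) by (apply Nat.leb_gt; lia).
    rewrite F. repeat split; auto.
    all: destruct (Nat.eq_dec l k) as [-> | Hl].
    all: try rewrite F; try rewrite Nat.leb_refl; try rewrite Nat.ltb_irrefl;
      rewrite ?E3, ?E4; auto; try apply X.
    all: assert (L : (l < k)%nat) by lia;
      rewrite ?(proj2 (Nat.ltb_lt l k) L), ?(proj2 (Nat.leb_le l k) (Nat.lt_le_incl _ _ L)),
        ?(proj2 (Nat.leb_le (S l) k) L); apply (IH l L).
Qed.

Lemma inQ_between x w s r :
  inQ n v x -> inQ n v (padd x (pscale s w)) -> 0 <= r <= s ->
  inQ n v (padd x (pscale r w)).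
Proof.
  intros H1 H2 Hr i Hi. specialize (H1 i Hi). specialize (H2 i Hi).
  rewrite cross_move in *. destruct (Rle_lt_dec 0 (cross (D i) w)); nra.
Qed.

Lemma side_offset j x : on_side n v j x -> cross (D j) x = cross (D j) (V j).
Proof. intros (l & _ & ->). coords; ring. Qed.

(** Convexity keeps the segment up to the exit point inside; beyond it the half-plane of side [j] is
    violated, since [w] points outward there. *)
Lemma leg_exit x w c j : (j < n)%nat -> exits n v w c j -> inQ n v x -> cross w x = c ->
  let y := exit_pt n v j w c in
  let t := dot (psub y x) w / dot w w in
  leg n v x w t /\ y = padd x (pscale t w).
Proof.
  intros Hj X Hx Hc y t.
  assert (Hy : y = padd x (pscale t w)).
  { apply parallel_difference; [eapply exits_dir_pos; eauto |].
    unfold y. rewrite exit_pt_offset; auto. }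
  assert (Ho : on_side n v j y) by (apply exit_pt_side; auto).
  pose proof (exits_outward _ _ _ _ _ X) as Hout.
  pose proof (Hx j Hj) as H0.
  assert (Zy : cross (D j) (psub y (V j)) = 0).
  { pose proof (side_offset _ _ Ho). coords; lra. }
  assert (Et : cross (D j) (psub x (V j)) + t * cross (D j) w = 0).
  { rewrite <- cross_move, <- Hy. exact Zy. }
  clearbody t y. split; auto. split; [nra | split].
  - intros s Hs. apply inQ_between with (s := t); auto.
    rewrite <- Hy. apply on_side_inQ with (j := j); auto.
  - intros s Hs H. specialize (H j Hj). rewrite cross_move in H. nra.
Qed.

Lemma sumR_ge_first t m : (forall k, (k < S m)%nat -> 0 <= t k) -> t 0%nat <= sumR t (S m).
Proof.
  induction m as [| m IH]; intro H; simpl in *; [lra |].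
  pose proof (H (S m) ltac:(lia)).
  assert (t 0%nat <= sumR t m + t m) by (apply IH; intros; apply H; lia).
  lra.
Qed.

(** The point [q] need not lie on the boundary: after the last bounce the trajectory is again on the
    line through [q] and runs on for a time [s] to reach it. *)
Lemma periodic_of_closed left m u c q :
  path n v (S m) u c u c -> inQ n v q -> cross u q = c -> periodic_point n v left q u.
Proof.
  intros P Hq Hc.
  destruct (path_states _ _ _ _ _ P) as (ws & cs & js & W0 & C0 & Wm & Cm & H).
  set (x := fun l => match l with
            | O => q
            | S l' => exit_pt n v (js l') (ws l') (cs l') end).
  set (t := fun l => dot (psub (x (S l)) (x l)) (ws l) / dot (ws l) (ws l)).
  assert (on : forall l, (l <= S m)%nat -> inQ n v (x l) /\ cross (ws l) (x l) = cs l).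
  { intros [| l] Hl.
    - simpl. rewrite W0, C0. auto.
    - destruct (H l) as (Hj & X & Ew & Ec); [lia |]. simpl.
      pose proof (exit_pt_side n v _ _ _ X) as Ho. split.
      + eapply on_side_inQ; eauto.
      + rewrite Ew, Ec. unfold bounced_offset. rewrite cross_refl.
        * rewrite exit_pt_offset; auto.
        * apply side_offset; auto. }
  assert (legs : forall l, (l < S m)%nat ->
    leg n v (x l) (ws l) (t l) /\ x (S l) = padd (x l) (pscale (t l) (ws l))).
  { intros l Hl. destruct (H l Hl) as (Hj & X & _). destruct (on l) as [O1 O2]; [lia |].
    apply leg_exit; auto. }
  destruct (H m) as (Hj & X & Ew & Ec); [lia |]. rewrite Wm in Ew. rewrite Cm in Ec.
  pose proof (bounce_enters n v _ _ _ X) as En. rewrite <- Ew, <- Ec in En.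
  destruct (H 0%nat) as (Hj0 & X0 & _ & _); [lia |]. rewrite W0, C0 in X0.
  set (s := dot (psub q (x (S m))) u / dot u u).
  assert (Hs : q = padd (x (S m)) (pscale s u)).
  { apply parallel_difference; [eapply exits_dir_pos; eauto |].
    destruct (on (S m)) as [_ O]; [lia |]. rewrite Wm, Cm in O. congruence. }
  assert (Hin : 0 < cross (D (js m)) u).
  { destruct En. unfold sidevec. coords; lra. }
  assert (Zm : cross (D (js m)) (psub (x (S m)) (V (js m))) = 0).
  { pose proof (side_offset _ _ (exit_pt_side n v _ _ _ X)) as E.
    simpl. revert E. generalize (exit_pt n v (js m) (ws m) (cs m)). intro. coords; lra. }
  assert (Hs0 : 0 <= s).
  { pose proof (Hq _ Hj) as Hqj. rewrite Hs, cross_move, Zm in Hqj. nra. }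
  exists (S m), x, ws, t, s. repeat split; auto.
  - apply legs; auto.
  - apply legs; auto.
  - apply legs; auto.
  - apply legs; auto.
  - left. exists (js k). destruct (H k H0) as (Hjk & Xk & Ewk & _).
    split; [auto | split; auto]. apply exit_pt_side; auto.
  - intros r Hr. rewrite Wm. apply inQ_between with (s := s); auto.
    + apply on; auto.
    + rewrite <- Hs; auto.
  - rewrite Wm. auto.
  - assert (Ht : forall k, (k < S m)%nat -> 0 <= t k) by (intros k Hk; apply legs; auto).
    pose proof (sumR_ge_first t m Ht) as Hsum.
    (* Otherwise [q] would be both the first and the last bounce point. One line cannot exit and
       enter through the same side, and an interior point of one side is not on another. *)
    destruct (Rle_lt_dec (t 0%nat + s) 0) as [Le |]; [exfalso | lra].
    pose proof (Ht 0%nat ltac:(lia)) as Ht0.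
    assert (s = 0) by lra. assert (t0 : t 0%nat = 0) by lra.
    destruct (legs 0%nat) as [_ L]; [lia |]. rewrite t0 in L.
    assert (E : x 1%nat = x (S m)).
    { rewrite L, W0. simpl (x 0%nat). rewrite Hs. rewrite H0. coords; apply pt_eq; simpl; ring. }
    destruct (Nat.eq_dec (js m) (js 0%nat)) as [Ej | Nj].
    + rewrite Ej in En. destruct En, X0. lra.
    + assert (O : on_side n v (js 0%nat) (x 1%nat)).
      { simpl. rewrite W0, C0. apply exit_pt_side; auto. }
      pose proof (on_side_left n v cp _ _ _ Hj0 Hj Nj O) as L'.
      rewrite E, Zm in L'. lra.
Qed.

End Periodicity.

(** * Directions and feet of perpendiculars *)

Definition rot (a : R) (e : pt) : pt :=
  (cos a * fst e - sin a * snd e, sin a * fst e + cos a * snd e).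

(** For a side of a counterclockwise polygon this is the inward unit normal. *)
Definition normal (d : pt) : pt := pscale (/ pnorm d) (- snd d, fst d).

Lemma pnorm_sqr d : pnorm d * pnorm d = dot d d.
Proof. unfold pnorm. apply sqrt_sqrt. destruct d; coords; nra. Qed.

Lemma pnorm_pos d : 0 < dot d d -> 0 < pnorm d.
Proof. apply sqrt_lt_R0. Qed.

Lemma refl_rot (r a b : R) (e : pt) : 0 < r -> dot e e = 1 ->
  refl (pscale r (rot b e)) (rot a e) = rot (2 * b - a) e.
Proof.
  intros Hr He. set (s := b - a).
  replace a with (b - s) by (unfold s; ring). clearbody s.
  replace (2 * b - (b - s)) with (b + s) by ring.
  assert (E1 : dot (pscale r (rot b e)) (pscale r (rot b e)) = r * r).
  { pose proof (sin2_cos2 b) as Hb. unfold Rsqr in Hb. revert He. unfold rot. coords. intro He.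
    replace (_ + _) with
      (r * r * (sin b * sin b + cos b * cos b) * (fst e * fst e + snd e * snd e)) by ring.
    rewrite Hb, He. ring. }
  assert (E2 : dot (rot (b - s) e) (pscale r (rot b e)) = r * cos s).
  { pose proof (sin2_cos2 b) as Hb. unfold Rsqr in Hb. revert He. unfold rot. coords. intro He.
    rewrite cos_minus, sin_minus.
    replace (_ + _) with
      (r * cos s * (sin b * sin b + cos b * cos b) * (fst e * fst e + snd e * snd e)) by ring.
    rewrite Hb, He. ring. }
  unfold refl. rewrite E1, E2. unfold rot. coords.
  rewrite cos_minus, sin_minus, cos_plus, sin_plus.
  apply pt_eq; simpl; field; lra.
Qed.

Lemma rot_period (a : R) (k : Z) (e : pt) : rot (a + 2 * IZR k * PI) e = rot a e.
Proof.
  assert (P : forall x (m : nat), rot (x + 2 * INR m * PI) e = rot x e).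
  { intros x m. unfold rot. rewrite cos_period, sin_period. reflexivity. }
  destruct (Z_le_gt_dec 0 k) as [H | H].
  - rewrite <- (Z2Nat.id k H), <- INR_IZR_INZ. apply P.
  - rewrite <- (P (a + 2 * IZR k * PI) (Z.to_nat (- k))). f_equal.
    rewrite INR_IZR_INZ, Z2Nat.id by lia. rewrite opp_IZR. ring.
Qed.

Lemma rot_finite (N : nat) (e : pt) : (0 < N)%nat ->
  exists W, forall w, In w W <-> exists k : Z, w = rot (IZR k * PI / INR N) e.
Proof.
  intro HN. pose proof (lt_0_INR N HN) as HR.
  exists (map (fun k => rot (IZR (Z.of_nat k) * PI / INR N) e) (seq 0 (2 * N))).
  intro w. rewrite in_map_iff. split.
  - intros (k & <- & _). eauto.
  - intros (k & ->).
    assert (H : (0 < 2 * Z.of_nat N)%Z) by lia.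
    pose proof (Z.mod_pos_bound k _ H) as Hm.
    exists (Z.to_nat (k mod (2 * Z.of_nat N))). rewrite Z2Nat.id by lia. split.
    + rewrite <- (rot_period _ (k / (2 * Z.of_nat N))). f_equal.
      rewrite (Z.div_mod k (2 * Z.of_nat N)) at 3 by lia.
      rewrite plus_IZR, !mult_IZR, <- INR_IZR_INZ. field. lra.
    + apply in_seq. lia.
Qed.

(** The cosine fixes the angle up to sign: the squares of [dot e d] and [cross e d] add up to that
    of [pnorm d], so [cross e d] is [sin a * pnorm d] or its negative. *)
Lemma angle_of_cos (e d : pt) (a : R) :
  dot e e = 1 -> cos a * pnorm d = dot e d ->
  d = pscale (pnorm d) (rot a e) \/ d = pscale (pnorm d) (rot (- a) e).
Proof.
  intros He Hc. pose proof (pnorm_sqr d) as Hn. pose proof (sin2_cos2 a) as Hs.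
  unfold Rsqr in Hs.
  assert (Hd : d = padd (pscale (dot e d) e) (pscale (cross e d) (- snd e, fst e))).
  { destruct e as [a1 a2], d as [d1 d2]. coords. apply pt_eq; simpl.
    - replace (_ + _) with (d1 * (a1 * a1 + a2 * a2)) by ring. rewrite He; ring.
    - replace (_ + _) with (d2 * (a1 * a1 + a2 * a2)) by ring. rewrite He; ring. }
  assert (L : dot e d * dot e d + cross e d * cross e d = dot d d * dot e e)
    by (coords; ring).
  rewrite He, <- Hn, <- Hc in L.
  set (N := pnorm d) in *. set (X := cross e d) in *.
  assert (F : (X - sin a * N) * (X + sin a * N) = 0).
  { replace ((X - sin a * N) * (X + sin a * N)) with
      (cos a * N * (cos a * N) + X * X - (sin a * sin a + cos a * cos a) * (N * N)) by ring.
    rewrite Hs, L. ring. }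
  apply Rmult_integral in F. rewrite Hd, <- Hc. unfold rot. rewrite cos_neg, sin_neg.
  destruct F as [F | F]; [left | right].
  - replace X with (sin a * N) by lra. coords. apply pt_eq; simpl; ring.
  - replace X with (- sin a * N) by lra. coords. apply pt_eq; simpl; ring.
Qed.

(* [s = 1] is the end of the side [d] in its own direction, [s = -1] the other
   end; [d'] is the side adjacent there and [p] is measured from the corner. *)
Lemma foot_beyond_corner (s : R) (d d' p : pt) :
  0 < s * cross d d' -> 0 <= s * dot d p -> 0 <= cross d p -> 0 <= cross d' p ->
  p <> (0, 0) -> 0 < dot d d -> 0 < dot d' d' ->
  0 <= dot d d' /\ cross d' p / pnorm d' < cross d p / pnorm d.
Proof.
  intros HX HA HP HP' Hp Hd Hd'.
  pose proof (pnorm_pos d Hd) as HN. pose proof (pnorm_pos d' Hd') as HN'.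
  pose proof (pnorm_sqr d) as SN. pose proof (pnorm_sqr d') as SN'.
  set (N := pnorm d) in *. set (N' := pnorm d') in *.
  assert (HAX : 0 <= dot d p * cross d d' /\ (dot d p <> 0 -> 0 < dot d p * cross d d')).
  { destruct (Rlt_le_dec 0 s).
    - assert (0 < cross d d') by nra. assert (0 <= dot d p) by nra.
      split; [nra |]. intro. nra.
    - assert (cross d d' < 0) by nra. assert (dot d p <= 0) by nra.
      split; [nra |]. intro. nra. }
  (* The first term on the right is at most 0 and the left side at least 0, which gives the sign of
     [dot d d']. Strict Cauchy-Schwarz ([CS]) then compares the two distances. *)
  assert (Id : N * N * cross d' p = - (dot d p * cross d d') + cross d p * dot d d').
  { rewrite SN. coords; ring. }
  assert (Pn : dot d p <> 0 \/ 0 < cross d p).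
  { destruct (Req_dec (dot d p) 0) as [E |]; auto. right.
    destruct HP as [| E']; auto. exfalso. apply Hp.
    destruct d as [d1 d2], p as [p1 p2]. coords.
    apply pt_eq; simpl; apply Rmult_eq_reg_l with (d1 * d1 + d2 * d2); try lra.
    - replace ((d1 * d1 + d2 * d2) * p1)
        with (d1 * (d1 * p1 + d2 * p2) - d2 * (d1 * p2 - d2 * p1)) by ring.
      rewrite E, <- E'; ring.
    - replace ((d1 * d1 + d2 * d2) * p2)
        with (d2 * (d1 * p1 + d2 * p2) + d1 * (d1 * p2 - d2 * p1)) by ring.
      rewrite E, <- E'; ring. }
  assert (CS : dot d d' < N * N').
  { assert (E : cross d d' * cross d d' + dot d d' * dot d d' = (N * N') * (N * N')).
    { replace ((N * N') * (N * N')) with ((N * N) * (N' * N')) by ring.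
      rewrite SN, SN'. coords; ring. }
    assert (0 < N * N') by nra. assert (0 < cross d d' * cross d d') by nra. nra. }
  assert (HNN : 0 < N * N) by nra.
  assert (HNP : 0 <= N * N * cross d' p) by (apply Rmult_le_pos; lra).
  destruct HAX as [HAX1 HAX2].
  split.
  - destruct (Rle_lt_dec 0 (dot d d')); auto. exfalso.
    destruct Pn as [Pn | Pn].
    + specialize (HAX2 Pn). nra.
    + nra.
  - assert (K : N * N * cross d' p < N * (cross d p * N')).
    { replace (N * (cross d p * N')) with (cross d p * (N * N')) by ring. rewrite Id.
      destruct Pn as [Pn | Pn].
      - specialize (HAX2 Pn). nra.
      - nra. }
    apply Rmult_lt_reg_r with (N * N'); [nra |].
    replace (cross d' p / N' * (N * N')) with (N * cross d' p) by (field; lra).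
    replace (cross d p / N * (N * N')) with (cross d p * N') by (field; lra).
    rewrite Rmult_assoc in K. apply Rmult_lt_reg_l in K; auto.
Qed.

Lemma argmin (f : nat -> R) (n : nat) : (0 < n)%nat ->
  exists i, (i < n)%nat /\ forall j, (j < n)%nat -> f i <= f j.
Proof.
  induction n as [| n IH]; [lia |]. intros _.
  destruct n as [| n].
  - exists 0%nat. split; [lia |]. intros j Hj. replace j with 0%nat by lia. lra.
  - destruct IH as (i & Hi & H); [lia |].
    destruct (Rle_lt_dec (f i) (f (S n))) as [L | L].
    + exists i. split; [lia |]. intros j Hj.
      destruct (Nat.eq_dec j (S n)) as [-> |]; auto. apply H; lia.
    + exists (S n). split; [lia |]. intros j Hj.
      destruct (Nat.eq_dec j (S n)) as [-> |]; [lra |].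
      specialize (H j ltac:(lia)). lra.
Qed.

Lemma list_choice (A B : Type) (Rl : A -> B -> Prop) (l : list A) :
  (forall a, In a l -> exists b, Rl a b) ->
  exists l', forall a, In a l -> exists b, In b l' /\ Rl a b.
Proof.
  induction l as [| a l IH]; intro H.
  - exists nil. intros a [].
  - destruct IH as [l' Hl']; [intros; apply H; right; auto |].
    destruct (H a (or_introl eq_refl)) as [b Hb].
    exists (b :: l'). intros a' [<- | Ha'].
    + exists b. split; [left |]; auto.
    + destruct (Hl' a' Ha') as (b' & ? & ?). exists b'. split; [right |]; auto.
Qed.

Lemma on_segment_line (p u : pt) (s0 s s1 : R) : s0 <= s <= s1 ->
  on_segment (padd p (pscale s0 u)) (padd p (pscale s1 u)) (padd p (pscale s u)).
Proof.
  intros [H0 H1]. destruct (Rle_lt_dec s1 s0) as [L | L].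
  - exists 0. split; [lra |]. replace s with s0 by lra. coords; apply pt_eq; simpl; ring.
  - exists ((s - s0) / (s1 - s0)).
    assert (E : (s - s0) / (s1 - s0) * (s1 - s0) = s - s0) by (field; lra).
    split.
    + split; apply Rmult_le_reg_r with (s1 - s0); rewrite ?E; lra.
    + revert E. generalize ((s - s0) / (s1 - s0)). intros l E.
      replace s with (s0 + l * (s1 - s0)) by lra. coords; apply pt_eq; simpl; ring.
Qed.

(** * Feet of perpendiculars on the sides of the polygon *)

Section Feet.

Context (n : nat) (v : nat -> pt) (cp : convex_polygon n v).

Local Notation V := (vtx n v).
Local Notation D := (sidevec n v).

Definition has_foot (i : nat) (q : pt) : Prop :=
  0 < dot (D i) (psub q (V i)) < dot (D i) (D i).

Definition side_dist (q : pt) (i : nat) : R :=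
  cross (D i) (psub q (V i)) / pnorm (D i).

(** The projection falls on or beyond one end of side [i]. There the adjacent side is strictly
    closer, and the inner angle is at least a right one, as the nonnegative dot product says. *)
Lemma no_foot q i : (i < n)%nat -> inQ n v q -> ~ is_vertex n v q -> ~ has_foot i q ->
  (side_dist q (Nat.modulo (S i) n) < side_dist q i /\ 0 <= dot (D i) (D (S i))) \/
  (exists k, (k < n)%nat /\ Nat.modulo (S k) n = i /\
     side_dist q k < side_dist q i /\ 0 <= dot (D k) (D (S k))).
Proof.
  intros Hi Hq Nv Nf.
  assert (Nz : forall j, psub q (V j) <> (0, 0)).
  { intros j E. apply Nv. exists (Nat.modulo j n). split; [apply (mod_lt n v cp) |].
    change (v (Nat.modulo j n)) with (V j). destruct q, (V j); coords.
    injection E as E1 E2. f_equal; lra. }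
  pose proof (dot_sidevec_pos n v cp i Hi) as Hd.
  destruct (Rlt_le_dec 0 (dot (D i) (psub q (V i)))) as [H0 | H0].
  - left. assert (H1 : dot (D i) (D i) <= dot (D i) (psub q (V i))).
    { apply Rnot_lt_le. intro. apply Nf. split; auto. }
    assert (E : cross (D i) (psub q (V (S i))) = cross (D i) (psub q (V i)))
      by (unfold sidevec; coords; ring).
    destruct (foot_beyond_corner 1 (D i) (D (S i)) (psub q (V (S i)))) as [A B]; auto.
    + pose proof (cross_consecutive n v cp i Hi). lra.
    + rewrite Rmult_1_l. revert H1. unfold sidevec. coords. lra.
    + rewrite E. apply Hq; auto.
    + rewrite <- sidevec_mod, <- (vtx_mod n v (S i)). apply Hq, (mod_lt n v cp).
    + rewrite <- sidevec_mod. apply dot_sidevec_pos; auto. apply (mod_lt n v cp).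
    + split; auto. unfold side_dist. rewrite sidevec_mod, vtx_mod, <- E. auto.
  - right. pose proof (n_ge3 n v cp) as Hn.
    assert (exists k, (k < n)%nat /\ Nat.modulo (S k) n = i) as (k & Hk & Ek).
    { destruct i as [| i].
      - exists (n - 1)%nat. split; [lia |]. replace (S (n - 1)) with n by lia.
        apply Nat.Div0.mod_same.
      - exists i. split; [lia |]. apply Nat.mod_small; lia. }
    exists k. split; auto. split; auto.
    assert (ED : D i = D (S k)) by (rewrite <- Ek; apply sidevec_mod).
    assert (EV : V i = V (S k)) by (rewrite <- Ek; apply vtx_mod).
    assert (E : cross (D k) (psub q (V (S k))) = cross (D k) (psub q (V k)))
      by (unfold sidevec; coords; ring).
    destruct (foot_beyond_corner (-1) (D i) (D k) (psub q (V i))) as [A B]; auto.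
    + rewrite ED. pose proof (cross_consecutive n v cp k Hk). coords; lra.
    + lra.
    + rewrite EV, E. apply Hq; auto.
    + apply dot_sidevec_pos; auto.
    + split.
      * unfold side_dist. rewrite <- E, <- EV. auto.
      * rewrite <- ED. coords; lra.
Qed.

Lemma nearest_side_foot q : inQ n v q -> ~ is_vertex n v q ->
  exists i, (i < n)%nat /\ has_foot i q.
Proof.
  intros Hq Nv. destruct (argmin (side_dist q) n) as (i & Hi & Hmin).
  { pose proof (n_ge3 n v cp). lia. }
  exists i. split; auto. apply NNPP; intro Nf.
  destruct (no_foot q i Hi Hq Nv Nf) as [[H _] | (k & Hk & _ & H & _)].
  - specialize (Hmin _ (mod_lt n v cp (S i))). lra.
  - specialize (Hmin k Hk). lra.
Qed.

(** * Perpendicular trajectories and their finitely many bad offsets *)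

Lemma normal_unit d : 0 < dot d d -> dot (normal d) (normal d) = 1.
Proof.
  intro H. pose proof (pnorm_pos d H) as Hp. pose proof (pnorm_sqr d) as E.
  unfold normal. set (N := pnorm d) in *.
  transitivity (/ N * / N * dot d d); [coords; ring |]. rewrite <- E. field. lra.
Qed.

Lemma refl_normal d : refl d (normal d) = pscale (-1) (normal d).
Proof.
  unfold refl. replace (dot (normal d) d) with 0.
  - unfold Rdiv. coords. apply pt_eq; simpl; ring.
  - unfold normal. coords; ring.
Qed.

Lemma foot_enters i q : (i < n)%nat ->
  has_foot i q -> enters n v (normal (D i)) (cross (normal (D i)) q) i.
Proof.
  intros Hi [H1 H2]. pose proof (pnorm_pos _ (dot_sidevec_pos n v cp i Hi)) as Hp.
  assert (E : forall x, cross (normal (D i)) x = / pnorm (D i) * - dot (D i) x)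
    by (intro; unfold normal; coords; ring).
  unfold enters. rewrite !E. apply Rinv_0_lt_compat in Hp.
  assert (E2 : dot (D i) (D i) = dot (D i) (V (S i)) - dot (D i) (V i))
    by (unfold sidevec at 2; coords; ring).
  assert (E3 : dot (D i) (psub q (V i)) = dot (D i) q - dot (D i) (V i)) by (coords; ring).
  split; apply Rmult_lt_compat_l; auto; lra.
Qed.

(** Measured from side 0, all sides have angles in the multiples of [PI / N] for a common
    denominator [N]. Reflection takes an angle [a] to [2 * b - a], so the multiples of
    [PI / (2 * N)] are preserved; the factor 2 makes room for the quarter turn to the normals. *)
Lemma invariant_directions : rational_polygon n v ->
  exists W, (forall w j, In w W -> (j < n)%nat -> In (refl (D j) w) W) /\
    forall i, (i < n)%nat -> In (normal (D i)) W.
Proof.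
  intro Hr. pose proof (n_ge3 n v cp) as Hn.
  set (e := pscale (/ pnorm (D 0)) (D 0)).
  pose proof (dot_sidevec_pos n v cp 0 ltac:(lia)) as Hd0.
  pose proof (pnorm_pos _ Hd0) as Hp0.
  assert (He : dot e e = 1).
  { transitivity (/ pnorm (D 0) * / pnorm (D 0) * dot (D 0) (D 0)).
    - unfold e. generalize (/ pnorm (D 0)). intro. coords; ring.
    - rewrite <- pnorm_sqr. field. lra. }
  assert (common : forall m, (m <= n)%nat -> exists N, (0 < N)%nat /\
    forall j, (j < m)%nat -> exists k : Z,
      D j = pscale (pnorm (D j)) (rot (IZR k * PI / INR N) e)).
  { induction m as [| m IH]; intro Hm.
    - exists 1%nat. split; [lia |]. lia.
    - destruct IH as (N & HN & H); [lia |].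
      destruct (Hr 0%nat m) as (p & M & HM & Hcos); [lia | lia |].
      pose proof (lt_0_INR N HN) as HN'. pose proof (lt_0_INR M HM) as HM'.
      exists (N * M)%nat. split; [nia |]. intros j Hj. rewrite mult_INR.
      destruct (Nat.eq_dec j m) as [-> | Hjm].
      + destruct (angle_of_cos e (D m) (IZR p * PI / INR M) He) as [A | A].
        * replace (dot e (D m)) with (/ pnorm (D 0) * dot (D 0) (D m)).
          -- rewrite <- Hcos. field. lra.
          -- unfold e. generalize (/ pnorm (D 0)). intro. coords; ring.
        * exists (p * Z.of_nat N)%Z. rewrite A at 1. do 2 f_equal.
          rewrite mult_IZR, <- INR_IZR_INZ. field. lra.
        * exists (- p * Z.of_nat N)%Z. rewrite A at 1. do 2 f_equal.
          rewrite mult_IZR, <- INR_IZR_INZ, opp_IZR. field. lra.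
      + destruct (H j) as [k Hk]; [lia |].
        exists (k * Z.of_nat M)%Z. rewrite Hk at 1. do 2 f_equal.
        rewrite mult_IZR, <- INR_IZR_INZ. field. lra. }
  destruct (common n (Nat.le_refl n)) as (N & HN & H).
  destruct (rot_finite (2 * N) e ltac:(lia)) as [W HW].
  pose proof (lt_0_INR N HN) as HN'.
  assert (E2N : INR (2 * N) = 2 * INR N) by (rewrite mult_INR; reflexivity).
  exists W. split.
  - intros w j Hw Hj. apply HW in Hw. destruct Hw as [k ->]. apply HW.
    destruct (H j Hj) as [l Hl].
    exists (4 * l - k)%Z. rewrite Hl, refl_rot; auto.
    + f_equal. rewrite E2N, minus_IZR, mult_IZR. field. lra.
    + apply pnorm_pos, dot_sidevec_pos; auto.
  - intros i Hi. apply HW. destruct (H i Hi) as [l Hl].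
    pose proof (pnorm_pos _ (dot_sidevec_pos n v cp i Hi)) as Hp.
    exists (2 * l + Z.of_nat N)%Z.
    rewrite E2N, plus_IZR, mult_IZR, <- INR_IZR_INZ.
    replace ((2 * IZR l + INR N) * PI / (2 * INR N)) with (IZR l * PI / INR N + PI / 2)
      by (field; lra).
    unfold normal. rewrite Hl at 2 3. unfold rot.
    rewrite cos_plus, sin_plus, cos_PI2, sin_PI2.
    set (P := pnorm _) in *. coords. apply pt_eq; simpl; field; lra.
Qed.

Lemma finite_offsets left : rational_polygon n v ->
  exists exc : list R, forall i q, (i < n)%nat -> Bset n v left q -> has_foot i q ->
    In (cross (normal (D i)) q) exc.
Proof.
  intro Hr. destruct (invariant_directions Hr) as (W & Wr & Wn).
  destruct (list_choice nat (list R)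
    (fun i l => forall q, Bset n v left q -> has_foot i q -> In (cross (normal (D i)) q) l)
    (seq 0 n)) as [ls Hls].
  - intros i Hi. apply in_seq in Hi.
    assert (Hi' : (i < n)%nat) by lia.
    destruct (exceptional_finite n v cp i Hi' _ W (Wn i Hi') Wr) as [l Hl].
    exists l. intros q (Hq & _ & Np) Hf. apply NNPP; intro Nin. apply Np.
    pose proof (foot_enters i q Hi' Hf) as En.
    destruct (returns_of_not_exceptional n v cp i Hi' _ W (Wn i Hi') Wr l _ Hl En Nin)
      as [k Hk].
    destruct (closed_of_returns n v cp i Hi' _ k _ (refl_normal _) En Hk) as [m Hm].
    exists (normal (D i)). split.
    + apply normal_unit, dot_sidevec_pos; auto.
    + eapply periodic_of_closed; eauto.
  - exists (concat ls). intros i q Hi HB Hf.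
    destruct (Hls i) as (l & Hl & H); [apply in_seq; lia |].
    apply in_concat. eauto.
Qed.

(** The perpendicular to side [i] at offset [b] is cut off by the half-planes of side [i] and of a
    side [j] where it points outward. *)
Lemma chord_segment i b : (i < n)%nat -> exists sg : pt * pt, forall q,
  inQ n v q -> has_foot i q -> cross (normal (D i)) q = b -> on_segment (fst sg) (snd sg) q.
Proof.
  intro Hi. set (u := normal (D i)).
  destruct (classic (enters n v u b i)) as [En | Nen].
  - destruct (offsets_cross_up n v cp u b i Hi En) as (j & Hj & J1 & J2).
    pose proof (dot_sidevec_pos n v cp i Hi) as Hd.
    pose proof (normal_unit _ Hd) as Hu. fold u in Hu.
    (* A point of offset [b], as [u] is a unit vector; [s0] and [s1] are the parameters at which the
       line through [p] meets the lines of sides [i] and [j]. *)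
    set (p := pscale b (- snd u, fst u)).
    assert (Ij : cross (D j) u < 0) by (unfold sidevec; coords; lra).
    assert (Ii : 0 < cross (D i) u) by (destruct En; unfold sidevec in *; coords; lra).
    set (s0 := - cross (D i) (psub p (V i)) / cross (D i) u).
    set (s1 := cross (D j) (psub p (V j)) / - cross (D j) u).
    exists (padd p (pscale s0 u), padd p (pscale s1 u)). intros q Hq _ Hb. simpl.
    assert (Eq : q = padd p (pscale (dot (psub q p) u / dot u u) u)).
    { apply parallel_difference; [lra |]. rewrite Hb. unfold p.
      transitivity (b * dot u u); [coords; ring | rewrite Hu; ring]. }
    set (s := dot (psub q p) u / dot u u) in Eq. clearbody s. rewrite Eq.
    apply on_segment_line.
    pose proof (Hq i Hi) as Qi. pose proof (Hq j Hj) as Qj.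
    rewrite Eq, cross_move in Qi, Qj. split.
    + apply Rmult_le_reg_r with (cross (D i) u); auto.
      unfold s0. replace (- cross (D i) (psub p (V i)) / cross (D i) u * cross (D i) u)
        with (- cross (D i) (psub p (V i))) by (field; lra). lra.
    + apply Rmult_le_reg_r with (- cross (D j) u); [lra |].
      unfold s1. replace (cross (D j) (psub p (V j)) / - cross (D j) u * - cross (D j) u)
        with (cross (D j) (psub p (V j))) by (field; lra). lra.
  (* A dummy segment: no point with a foot on side [i] has this offset. *)
  - exists ((0, 0), (0, 0)). intros q _ Hf E. exfalso. apply Nen.
    rewrite <- E. apply foot_enters; auto.
Qed.

End Feet.

(* A triangle has at most one angle that is not acute, and only one of the two
   sides meeting there can miss the foot of the perpendicular. *)
Lemma triangle_two_feet v q : convex_polygon 3 v -> inQ 3 v q -> ~ is_vertex 3 v q ->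
  exists i, (i < 3)%nat /\ has_foot 3 v i q /\ has_foot 3 v (Nat.modulo (S i) 3) q.
Proof.
  intros cp Hq Nv.
  pose proof (fun i Hi => no_foot 3 v cp q i Hi Hq Nv) as F.
  pose proof (dot_sidevec_pos 3 v cp) as P.
  set (obtuse := fun i => 0 <= dot (sidevec 3 v i) (sidevec 3 v (S i))) in *.
  (* The three side vectors add up to 0, so the two dot products sum to minus the squared length of
     the middle side. *)
  assert (O : forall i, (i < 3)%nat -> obtuse i -> ~ obtuse (Nat.modulo (S i) 3)).
  { intros i Hi. pose proof (P _ (mod_lt 3 v cp (S i))) as Pi. revert Pi.
    unfold obtuse. rewrite <- (sidevec_mod 3 v (S (Nat.modulo (S i) 3))).
    destruct i as [| [| [| i]]]; [| | | lia]; unfold sidevec, vtx; simpl;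
      coords; intros H1 H2 H3; clear - H1 H2 H3; lra. }
  assert (F' : forall i, (i < 3)%nat -> has_foot 3 v i q \/
    (side_dist 3 v q (Nat.modulo (S i) 3) < side_dist 3 v q i /\ obtuse i) \/
    (side_dist 3 v q (Nat.modulo (S (S i)) 3) < side_dist 3 v q i /\
       obtuse (Nat.modulo (S (S i)) 3))).
  { intros i Hi. destruct (classic (has_foot 3 v i q)) as [| Nf]; auto. right.
    destruct (F i Hi Nf) as [? | (k & Hk & Ek & ?)]; [left; auto | right].
    replace (Nat.modulo (S (S i)) 3) with k; auto.
    destruct k as [| [| [| k]]]; simpl in Ek; subst; auto; lia. }
  clear F P Nv Hq. clearbody obtuse.
  pose proof (F' 0%nat ltac:(lia)) as F0. pose proof (F' 1%nat ltac:(lia)) as F1.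
  pose proof (F' 2%nat ltac:(lia)) as F2.
  pose proof (O 0%nat ltac:(lia)) as O0. pose proof (O 1%nat ltac:(lia)) as O1.
  pose proof (O 2%nat ltac:(lia)) as O2.
  clear F' O. simpl in *.
  assert (C : (has_foot 3 v 0 q /\ has_foot 3 v 1 q) \/ (has_foot 3 v 1 q /\ has_foot 3 v 2 q)
     \/ (has_foot 3 v 2 q /\ has_foot 3 v 0 q)).
  { destruct F0 as [F0 | [F0 | F0]]; destruct F1 as [F1 | [F1 | F1]];
      destruct F2 as [F2 | [F2 | F2]]; try tauto; exfalso;
      try (destruct F0, F1, F2; lra); try (destruct F0, F1; lra);
      try (destruct F1, F2; lra); try (destruct F0, F2; lra). }
  destruct C as [C | [C | C]]; [exists 0%nat | exists 1%nat | exists 2%nat]; simpl; split; auto.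
Qed.

Theorem theorem4 (n : nat) (v : nat -> pt) (left : bool) :
  convex_polygon n v -> rational_polygon n v ->
  (exists segs : list (pt * pt),
     forall q, Bset n v left q -> exists sg, In sg segs /\ on_segment (fst sg) (snd sg) q) /\
  (n = 3%nat -> exists pts : list pt, forall q, Bset n v left q -> In q pts).
Proof.
  intros cp Hr. destruct (finite_offsets n v cp left Hr) as [exc Hexc]. split.
  - destruct (list_choice (nat * R) (pt * pt)
      (fun p sg => forall q, inQ n v q -> has_foot n v (fst p) q ->
         cross (normal (sidevec n v (fst p))) q = snd p -> on_segment (fst sg) (snd sg) q)
      (list_prod (seq 0 n) exc)) as [segs Hsegs].
    + intros [i b] H. apply in_prod_iff in H. destruct H as [H _]. apply in_seq in H.
      apply (chord_segment n v cp i b). lia.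
    + exists segs. intros q HB. pose proof HB as (Hq & Nv & _).
      destruct (nearest_side_foot n v cp q Hq Nv) as (i & Hi & Hf).
      destruct (Hsegs (i, cross (normal (sidevec n v i)) q)) as (sg & Hsg & H).
      * apply in_prod; [apply in_seq; lia | apply Hexc; auto].
      * exists sg. split; auto.
  - intros ->.
    (* Cramer's rule: the point with given offsets for the normals of two consecutive sides, which
       are not parallel. *)
    set (meet := fun p : nat * (R * R) =>
      let u := normal (sidevec 3 v (fst p)) in
      let u' := normal (sidevec 3 v (S (fst p))) in
      pscale (/ cross u u') (psub (pscale (fst (snd p)) u') (pscale (snd (snd p)) u))).
    exists (map meet (list_prod (seq 0 3) (list_prod exc exc))).
    intros q HB. pose proof HB as (Hq & Nv & _).
    destruct (triangle_two_feet v q cp Hq Nv) as (i & Hi & F1 & F2).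
    pose proof (mod_lt 3 v cp (S i)) as Hi'.
    apply in_map_iff.
    exists (i, (cross (normal (sidevec 3 v i)) q, cross (normal (sidevec 3 v (S i))) q)). split.
    + unfold meet; simpl fst; simpl snd.
      assert (X : cross (normal (sidevec 3 v i)) (normal (sidevec 3 v (S i))) <> 0).
      { pose proof (cross_consecutive 3 v cp i Hi) as Hc.
        pose proof (pnorm_pos _ (dot_sidevec_pos 3 v cp i Hi)) as H1.
        pose proof (pnorm_pos _ (dot_sidevec_pos 3 v cp _ Hi')) as H2.
        rewrite sidevec_mod in H2. apply Rinv_0_lt_compat in H1, H2.
        unfold normal. set (r := / _) in *. set (r' := / pnorm (sidevec 3 v (S i))) in *.
        assert (0 < r * r') by nra.
        assert (0 < r * r' * cross (sidevec 3 v i) (sidevec 3 v (S i))) by nra.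
        coords; lra. }
      revert X. generalize (normal (sidevec 3 v i)), (normal (sidevec 3 v (S i))).
      intros [a1 a2] [b1 b2]. destruct q as [q1 q2]. coords. intro X.
      apply pt_eq; simpl; field; auto.
    + apply in_prod; [apply in_seq; lia |]. apply in_prod; [auto |].
      rewrite <- sidevec_mod. apply Hexc; auto.
Qed.
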